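(* For all integers $k,d\ge1$ with $k\le 2d$, we have $\theta^{\rm D}(k+1,d+1)\ge\theta^{\rm D}(k,d)$.
   Context: For integers $d\ge1$ and $1\le k\le 2d$, the directed $k$-neighbor graph ($k$-DnG) on $\mathbb{Z}^d$ is the random directed graph obtained by letting each vertex $x\in\mathbb{Z}^d$, independently of all other vertices, choose a uniformly random subset of exactly $k$ of its $2d$ nearest neighbors (in $\ell_1$-distance), and placing a directed edge from $x$ to each chosen neighbor. We write $\theta^{\rm D}(k,d)=\mathbb{P}(o\rightsquigarrow\infty \text{ in the $k$-DnG on }\mathbb{Z}^d)$, where $o$ is the origin and $o\rightsquigarrow\infty$ is the event that there is an infinite self-avoiding directed path along edges of the $k$-DnG starting at $o$. *)

(* Defs.v *)
From HB Require Import structures.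
From mathcomp Require Import all_boot all_order all_algebra.
From mathcomp Require Import all_classical all_reals all_analysis.
Set Implicit Arguments. Unset Strict Implicit. Unset Printing Implicit Defensive.
Import Order.TTheory GRing.Theory Num.Theory.
Local Open Scope classical_set_scope.
Local Open Scope ring_scope.

Definition vertex (d : nat) := {ffun 'I_d -> int}.
Definition origin (d : nat) : vertex d := [ffun => 0%R].

(* The 2d nearest neighbours (l1-distance 1) of x are x + e_i and x - e_i;
   a direction (i, true) means +e_i, (i, false) means -e_i.  The map
   dir |-> step x dir is a bijection from 'I_d * bool onto the neighbours. *)
Definition dir (d : nat) := ('I_d * bool)%type.
Definition step (d : nat) (x : vertex d) (u : dir d) : vertex d :=
  [ffun i => if i == u.1 then x i + (if u.2 then 1 else -1) else x i].

Definition config (d : nat) := vertex d -> {set dir d}.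

Definition dedge (d : nat) (c : config d) (x y : vertex d) : Prop :=
  exists2 u, u \in c x & y = step x u.

Definition reaches_infinity (d : nat) (c : config d) : Prop :=
  exists p : nat -> vertex d,
    [/\ p 0%N = origin d, injective p & forall n, dedge c (p n) (p n.+1)].

(* w is a k-DnG on Z^d defined on the probability space (T, P):
   the choices w x are random variables (measurable), mutually independent,
   each uniformly distributed on the k-subsets of the 2d directions. *)
Definition kDnG_law (R : realType) (dT : measure_display) (T : measurableType dT)
    (P : probability T R) (k d : nat) (w : vertex d -> T -> {set dir d}) : Prop :=
  (forall x S, measurable [set t | w x t = S]) /\
  (forall (xs : seq (vertex d)) (S : vertex d -> {set dir d}), uniq xs ->
     P [set t | forall x, x \in xs -> w x t = S x] =
     (\prod_(x <- xs) (if #|S x| == k then ('C(d.*2, k))%:R^-1 else 0))%:E).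

Definition perc_event (dT : measure_display) (T : measurableType dT) (d : nat)
    (w : vertex d -> T -> {set dir d}) : set T :=
  [set t | reaches_infinity (fun x => w x t)].
Arguments kDnG_law {R dT T} P k d w.

(* Main.v *)
(** Explore the out-cluster of the origin in Z^d one vertex at a time, and follow
    this exploration in Z^(d+1) so that every discovered x in Z^d has a reachable
    lift (x, h).  When x comes up for exploration, its column is still unrevealed
    above and at h: reveal (x, h), (x, h + 1), ... until the horizontal directions
    seen so far number at least k.  As long as they do not, the vertex just revealed
    has at most k - 1 horizontal directions among its k + 1, so it points up and the
    climb goes on (an endless climb already gives an infinite cluster).  By
    symmetry, a k-subset of the directions found can be selected so that it is
    uniform, which makes the projected exploration that of the k-DnG on Z^d.
    The comparison is made for finite truncations, and Koenig's lemma together with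
    continuity from above passes to the limit. *)
Require Import Defs.
From HB Require Import structures.
From mathcomp Require Import all_boot all_order all_algebra.
From mathcomp Require Import fingroup perm.
From mathcomp Require Import all_classical all_reals all_analysis.
Import Order.TTheory GRing.Theory Num.Theory.
Local Open Scope classical_set_scope.
Local Open Scope ring_scope.

Set Implicit Arguments.
Unset Strict Implicit.
Unset Printing Implicit Defensive.

(** * Koenig's lemma for prefix-closed sets of finite sequences *)

Lemma koenig (V : eqType) (T : seq V -> Prop) (nb : seq V -> seq V) :
  (forall s a, T (rcons s a) -> T s) ->
  (forall s a, T (rcons s a) -> a \in nb s) ->
  (forall n, exists2 s, size s = n & T s) ->
  exists f : nat -> V, forall n, T (mkseq f n).
Proof.
move=> Tpre Tnb Tinf.
have Tcat s r : T (s ++ r) -> T s.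
  elim/last_ind: r => [|r a IH]; first by rewrite cats0.
  by rewrite -rcons_cat => /Tpre.
pose inf s := forall n, exists2 r, size r = n & T (s ++ r).
(* Otherwise each child [a] has a length [g a] at which its extensions have died out; an extension
   of [s] one longer than the maximum of [g] over [nb s] contradicts this. *)
have inf_step s : inf s -> exists a, inf (rcons s a).
  move=> infs; apply: contrapT => noa.
  have /choice[g gP] a : exists n, forall r, size r = n -> ~ T (rcons s a ++ r).
    apply: contrapT => non; apply: noa; exists a => n.
    apply: contrapT => nor; apply: non; exists n => r rn Tr.
    by apply: nor; exists r.
  have [[|a r]//= [rN] Tr] := infs (\max_(a <- nb s) g a).+1.
  rewrite -cat_rcons in Tr.
  have ga : (g a <= size r)%N.
    by rewrite rN; apply: leq_bigmax_seq => //; apply: Tnb; apply: Tcat Tr.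
  apply: (gP a (take (g a) r)); first by rewrite size_takel.
  by apply: (Tcat _ (drop (g a) r)); rewrite -catA cat_take_drop.
have inf0 : inf [::] by move=> n; have [s sn Ts] := Tinf n; exists s.
have /choice[F FP] s : exists a, inf s -> inf (rcons s a).
  have [/inf_step[a ?]|nos] := pselect (inf s); first by exists a.
  have [[|a ?]//= _ _] := Tinf 1%N.
  by exists a.
pose st := fix st n := if n is m.+1 then rcons (st m) (F (st m)) else [::].
exists (fun n => F (st n)) => n.
have -> : mkseq (fun n => F (st n)) n = st n.
  by elim: n => [|n IH]//=; rewrite mkseqS IH.
suff /(_ 0%N)[r /size0nil-> ] : inf (st n) by rewrite cats0.
by elim: n => [|n IH] //=; apply: FP.
Qed.

(** * Reachability and self-avoiding walks from the origin *)

Section Paths.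
Variable d : nat.
Implicit Types (c : config d) (x y : vertex d) (p s : seq (vertex d)).
Local Notation o := (origin d).

Definition edge c : rel (vertex d) :=
  fun x y => [exists u, (u \in c x) && (y == step x u)].

Lemma edgeP c x y : reflect (dedge c x y) (edge c x y).
Proof.
apply: (iffP existsP) => [[u /andP[uc /eqP->]]|[u uc ->]]; exists u => //.
by rewrite uc eqxx.
Qed.

Definition reach c y := exists2 p, path (edge c) o p & last o p = y.

Definition saw c n :=
  exists p, [/\ path (edge c) o p, uniq (o :: p) & size p = n].

Lemma reach_origin c : reach c o.
Proof. by exists [::]. Qed.

Lemma reach_step c x u : reach c x -> u \in c x -> reach c (step x u).
Proof.
move=> [p pp px] uc; exists (rcons p (step x u)); last by rewrite last_rcons.
by rewrite rcons_path pp px; apply/edgeP; exists u.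
Qed.

Lemma saw_leq c m n : (m <= n)%N -> saw c n -> saw c m.
Proof.
move=> mn [p [pp up pn]]; exists (take m p); split.
- exact: take_path.
- exact: (@take_uniq _ (o :: p) m.+1).
- by rewrite size_takel // pn.
Qed.

(** Koenig's lemma applies to the tree of self-avoiding walks, since a walk has at most [2d]
    one-step extensions. *)
Lemma reaches_infinityP c : reaches_infinity c <-> forall n, saw c n.
Proof.
split=> [[p [p0 pinj pe]] n|sawc].
  exists (mkseq (p \o succn) n).
  have eqp : o :: mkseq (p \o succn) n = mkseq p n.+1.
    by rewrite -p0 /mkseq /= -[1%N]/(1 + 0)%N iotaDl -map_comp.
  split; last by rewrite size_mkseq.
    apply/(pathP o) => i; rewrite size_mkseq => ilt.
    rewrite eqp nth_mkseq ?nth_mkseq//=; last by rewrite ltnW.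
    exact/edgeP/pe.
  by rewrite eqp map_inj_uniq ?iota_uniq.
pose T s := path (edge c) o s && uniq (o :: s).
pose nb s := [seq step (last o s) u | u <- enum {: dir d}].
have [|||f fP] := @koenig _ T nb.
- move=> s a /andP[]; rewrite /T rcons_path -rcons_cons rcons_uniq.
  by move=> /andP[-> _] /andP[_ ->].
- move=> s a /andP[]; rewrite rcons_path => /andP[_ /edgeP[u _ ->]] _.
  by apply: map_f; rewrite mem_enum.
- by move=> n; have [p [pp up pn]] := sawc n; exists p; rewrite // /T pp up.
pose p n := if n is m.+1 then f m else o.
have pE n i : (i <= n)%N -> nth o (o :: mkseq f n) i = p i.
  by case: i => //= i ilt; rewrite nth_mkseq.
exists p; split=> //.
- move=> i j pij; have /andP[_] := fP (maxn i j).
  move=> /(nth_uniq o) => /(_ i j).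
  rewrite !pE ?leq_maxl ?leq_maxr // /= size_mkseq !ltnS leq_maxl leq_maxr.
  by move=> /(_ isT isT); rewrite pij eqxx => /esym/eqP.
- move=> n; apply/edgeP; have /andP[/(pathP o) + _] := fP n.+1.
  move=> /(_ n); rewrite size_mkseq => /(_ (ltnSn n)).
  by rewrite pE // nth_mkseq.
Qed.

Fixpoint ball n : seq (vertex d) :=
  if n is m.+1 then
    ball m ++ [seq step x u | x <- ball m, u <- enum {: dir d}]
  else [:: o].

Lemma last_ball c p n :
  path (edge c) o p -> (size p <= n)%N -> last o p \in ball n.
Proof.
elim: n p => [|n IH] p; first by case: p => //= _ _; rewrite inE.
case/lastP: p => [|p x] /=.
  by move=> _ _; rewrite mem_cat (IH [::]).
rewrite rcons_path size_rcons ltnS last_rcons => /andP[pp /edgeP[u _ ->]] pn.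
rewrite mem_cat orbC; apply/orP; left.
by apply/allpairsP; exists (last o p, u); rewrite /= IH ?mem_enum.
Qed.

(** Without a self-avoiding walk of [n] steps, paths shortened to be self-avoiding keep every
    reachable vertex inside [ball n]. So counting reachable vertices suffices, with [N] independent
    of the configuration. *)
Lemma saw_of_reach n :
  exists N, forall c s,
    uniq s -> (N <= size s)%N -> (forall y, y \in s -> reach c y) -> saw c n.
Proof.
exists (size (ball n)).+1 => c s us Ns sr; apply: contrapT => nsaw.
suff /(uniq_leq_size us) : {subset s <= ball n} by rewrite leqNgt Ns.
move=> y /sr[p /shortenP[q pq uq _] <-]; apply: (last_ball pq).
rewrite leqNgt; apply/negP => /ltnW nq; apply: nsaw; apply: saw_leq nq _.
by exists q.
Qed.

Lemma finite_trap c s :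
  o \in s -> (forall x u, x \in s -> u \in c x -> step x u \in s) ->
  ~ reaches_infinity c.
Proof.
move=> os sc [p [p0 pinj pe]].
have ps n : p n \in s.
  by elim: n => [|n IH]; [rewrite p0|have [u uc ->] := pe n; apply: sc].
have /uniq_leq_size : uniq (mkseq p (size s).+1).
  by rewrite map_inj_uniq ?iota_uniq.
move=> /(_ s); rewrite size_mkseq ltnn => H.
by suff: false by []; apply: H => _ /mapP[n _ ->].
Qed.

End Paths.

(** * Uniform [k]-subsets and permutations of a finite set *)

Lemma perm_imset_eq (T : finType) (A B : {set T}) :
  #|A| = #|B| -> exists s : {perm T}, [set s x | x in A]%SET = B.
Proof.
move=> AB.
(* Each set is listed before its complement; the permutation matches the lists of [A] and [B]
   position by position. *)
pose e (C : {set T}) := enum C ++ enum (~: C)%SET.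
have e_uniq C : uniq (e C).
  rewrite cat_uniq !enum_uniq /= andbT; apply/hasPn => x.
  by rewrite !mem_enum inE.
have mem_e C x : x \in e C by rewrite mem_cat !mem_enum inE orbN.
have size_e C : size (e C) = #|T| by rewrite size_cat -!cardE cardsC.
pose f x := nth x (e B) (index x (e A)).
have index_lt x : (index x (e A) < size (e B))%N.
  by rewrite size_e -(size_e A) index_mem.
have f_inj : injective f.
  move=> x y; rewrite /f (set_nth_default y) // => /eqP.
  rewrite nth_uniq // => /eqP xy.
  by rewrite -[x](nth_index x (mem_e A x)) xy (set_nth_default y) ?nth_index //
     size_e -(size_e B).
exists (perm f_inj); apply/eqP.
rewrite eqEcard card_imset ?AB ?leqnn; last exact: perm_inj.
rewrite andbT; apply/fintype.subsetP => _ /imsetP[x xA ->]; rewrite permE /f.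
have ltB : (index x (e A) < size (enum B))%N.
  by rewrite index_cat mem_enum xA -cardE -AB cardE index_mem mem_enum.
by rewrite nth_cat ltB -mem_enum mem_nth.
Qed.

Section Uniform.
Context {R : realFieldType}.

Definition unif (T : finType) (k : nat) (S : {set T}) : R :=
  if #|S| == k then 'C(#|T|, k)%:R^-1 else 0.

Lemma unif_ge0 (T : finType) k (S : {set T}) : 0 <= unif k S.
Proof. by rewrite /unif; case: ifP => // _; rewrite invr_ge0. Qed.

Lemma sum_unif (T : finType) k (F : {set T} -> R) :
  \sum_S unif k S * F S = 'C(#|T|, k)%:R^-1 * \sum_(S : {set T} | #|S| == k) F S.
Proof.
rewrite mulr_sumr [RHS]big_mkcond; apply: eq_bigr => S _.
by rewrite /unif; case: ifP => // _; rewrite mul0r.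
Qed.

Lemma sum_unif1 (T : finType) k :
  (k <= #|T|)%N -> \sum_(S : {set T}) unif k S = 1 :> R.
Proof.
move=> kT; under eq_bigr do rewrite -[unif _ _]mulr1.
rewrite sum_unif.
have -> : \sum_(S : {set T} | #|S| == k) 1 = 'C(#|T|, k)%:R :> R.
  by rewrite -card_draws -sum1_card natr_sum; apply: eq_bigl => S; rewrite inE.
by rewrite mulVf // pnatr_eq0 -lt0n bin_gt0.
Qed.

(** The left side depends on [K] only through its size, as a permutation between two [k]-subsets is
    absorbed into [s]. So [K] may be averaged uniformly, and each [s] preserves the uniform law. *)
Lemma sum_perm_imset (T : finType) k (F : {set T} -> R) (K : {set T}) :
  (k <= #|T|)%N -> #|K| = k ->
  \sum_(s : {perm T}) F [set s x | x in K]%SET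
    = #|{perm T}|%:R * \sum_S unif k S * F S.
Proof.
move=> kT Kk.
pose Phi (K : {set T}) := \sum_(s : {perm T}) F [set s x | x in K]%SET.
have PhiE (K' : {set T}) : #|K'| == k -> Phi K' = Phi K.
  move=> /eqP Kk'; have [|t <-] := @perm_imset_eq _ K K'; first by rewrite Kk.
  rewrite /Phi [RHS](reindex_inj (mulgI t)) /=.
  apply: eq_bigr => s _; rewrite -imset_comp; congr F.
  by apply: eq_imset => x; rewrite /= permM.
have : \sum_S unif k S * Phi S = Phi K.
  transitivity (\sum_(S : {set T}) unif k S * Phi K).
    apply: eq_bigr => S _; rewrite /unif.
    by case: ifP => [/PhiE-> //|_]; rewrite !mul0r.
  by rewrite -mulr_suml sum_unif1 // mul1r.
rewrite -/(Phi K) => <-.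
under eq_bigr do rewrite mulr_sumr.
rewrite exchange_big /= mulr_natl -sumr_const; apply: eq_bigr => s _.
rewrite (reindex_inj (imset_inj (@perm_inj _ s^-1%g))) /=.
apply: eq_bigr => S _; rewrite /unif card_imset; last exact: perm_inj.
congr (_ * F _); rewrite -imset_comp -[RHS]imset_id.
by apply: eq_imset => x; rewrite /= permKV.
Qed.

End Uniform.

(** * Climbing one column and selecting [k] horizontal directions *)

Section Climb.
Context {R : realFieldType}.
Variables (T A : finType) (k : nat) (hor : A -> {set T}) (mu : A -> R).

(* Expected value of [F (pick U')], where [U'] is the first of the successive unions
   of [U] with independent [mu]-distributed [hor S] to have at least [k] elements;
   if there is none after [m] unions, the value is [1]. *)
Fixpoint climb m (F : {set T} -> R) (pick : {set T} -> {set T}) U : R :=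
  if m is m'.+1 then
    \sum_S mu S * (let U' := (U :|: hor S)%SET in
                   if (k <= #|U'|)%N then F (pick U') else climb m' F pick U')
  else 1.

Implicit Types (m : nat) (K U V : {set T}) (F : {set T} -> R).
Implicit Types (pick : {set T} -> {set T}).

Hypothesis mu_ge0 : forall S, 0 <= mu S.
Hypothesis mu_sum1 : \sum_S mu S = 1.
Hypothesis mu_perm : forall s : {perm T}, exists h : A -> A,
  [/\ injective h, forall S, mu (h S) = mu S
    & forall S, hor (h S) = [set s x | x in hor S]%SET].
Hypothesis kT : (k <= #|T|)%N.

(** The law of the revealed sets is invariant under relabelling [T], so conjugating the selection
    rule by [s] amounts to letting [F] see the selected set through [s]. *)
Lemma climb_perm m F pick (s : {perm T}) U :
  climb m F (fun V : {set T} => [set s x | x in pick [set s^-1%g x | x in V]])%SET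
          [set s x | x in U]%SET
  = climb m (fun K => F [set s x | x in K]%SET) pick U.
Proof.
elim: m U => [//|m IH] U /=; have [h [h_inj muh horh]] := mu_perm s.
rewrite (reindex_inj h_inj) /=; apply: eq_bigr => S _.
rewrite muh horh -imsetU card_imset; last exact: perm_inj.
rewrite IH -[X in pick X]imset_comp.
suff -> : [set (s^-1%g \o s) x | x in U :|: hor S]%SET = (U :|: hor S)%SET by [].
by rewrite -[RHS]imset_id; apply: eq_imset => x; rewrite /= permK.
Qed.

(** Wherever the climb stops, the selected set has [k] elements, so summing over [s] makes it
    uniform. If it has not stopped after [m] steps, the value 1 dominates because [F] is at most
    1. *)
Lemma climb_sum_perm m F pick U :
  (forall K, F K <= 1) -> (forall V, (k <= #|V|)%N -> #|pick V| = k) ->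
  #|{perm T}|%:R * (\sum_S unif k S * F S)
    <= \sum_(s : {perm T}) climb m (fun K => F [set s x | x in K]%SET) pick U.
Proof.
move=> F1 pickk; set a := (X in X <= _).
have a_le : a <= #|{perm T}|%:R.
  rewrite -[leRHS]mulr1 ler_wpM2l // -(sum_unif1 kT).
  apply: ler_sum => S _; rewrite -[leRHS]mulr1.
  by apply: ler_wpM2l; [exact: unif_ge0|exact: F1].
elim: m U => [|m IH] U /=; first by rewrite sumr_const.
rewrite exchange_big /= -[leLHS]mul1r -mu_sum1 mulr_suml.
apply: ler_sum => S _; rewrite -mulr_sumr; apply: ler_wpM2l => //.
by case: (boolP (k <= _)%N) => // kU; rewrite (@sum_perm_imset _ _ k) // pickk.
Qed.

(* Averaging over conjugates of a fixed selection rule avoids any external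
   randomness: some conjugate does at least as well as the uniform average. *)
Lemma exists_pick m F : (forall K, F K <= 1) ->
  exists2 pick : {set T} -> {set T},
    forall V, (k <= #|V|)%N -> (pick V \subset V)%SET /\ #|pick V| = k
  & \sum_S unif k S * F S <= climb m F pick finset.set0.
Proof.
move=> F1.
have /choice[pick pickP] V : exists K : {set T},
    (k <= #|V|)%N -> (K \subset V)%SET /\ #|K| = k.
  have [kV|] := leqP k #|V|; last by exists V.
  have /card_geqP[r [ur rk rV]] := kV; exists [set x in r]%SET => _.
  split; first by apply/fintype.subsetP => x; rewrite inE => /rV.
  by rewrite cardsE (card_uniqP ur).
pose conj (s : {perm T}) V :=
  [set s x | x in pick [set s^-1%g x | x in V]]%SET.
have conjP s V : (k <= #|V|)%N -> (conj s V \subset V)%SET /\ #|conj s V| = k.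
  move=> kV; have [|sub card] := pickP [set s^-1%g x | x in V]%SET.
    by rewrite card_imset //; apply: perm_inj.
  split; last by rewrite card_imset //; apply: perm_inj.
  apply/fintype.subsetP => _ /imsetP[x /(fintype.subsetP sub) + ->].
  by move=> /imsetP[y yV ->]; rewrite permKV.
apply: contrapT => nopick.
have lt s : climb m F (conj s) finset.set0 < \sum_S unif k S * F S.
  rewrite real_ltNge ?num_real //; apply/negP => le; apply: nopick.
  by exists (conj s) => // V; apply: conjP.
have := @climb_sum_perm m F pick finset.set0 F1 (fun V kV => (pickP V kV).2).
apply/negP; rewrite -real_ltNge ?num_real //.
rewrite mulr_natl -sumr_const; apply: ltr_sum => [|s _].
  by apply/hasP; exists 1%g; rewrite ?mem_index_enum.
by rewrite -climb_perm imset0; apply: lt.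
Qed.
End Climb.

(** * Columns of Z^(d+1) over Z^d, with the last coordinate as height *)

Section Lift.
Variable d : nat.
Implicit Types (x : vertex d) (h : int) (u : dir d) (S : {set dir d.+1}).

Definition hdir u : dir d.+1 := (lift ord_max u.1, u.2).
Definition vdir : dir d.+1 := (ord_max, true).
Definition hor S : {set dir d} := [set u | hdir u \in S]%SET.
Definition col x h : vertex d.+1 :=
  [ffun i => if unlift ord_max i is Some j then x j else h].

Lemma col_inj x y h h' : col x h = col y h' -> x = y /\ h = h'.
Proof.
move=> /ffunP xy; split; last by have := xy ord_max; rewrite !ffunE unlift_none.
by apply/ffunP => j; have := xy (lift ord_max j); rewrite !ffunE liftK.
Qed.

Lemma col_origin : col (origin d) 0 = origin d.+1.
Proof. by apply/ffunP => i; rewrite !ffunE; case: unlift => // j; rewrite ffunE. Qed.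

Lemma step_hdir x h u : step (col x h) (hdir u) = col (step x u) h.
Proof.
apply/ffunP => i; rewrite !ffunE /=; case: unliftP => [j ->|->].
  by rewrite (inj_eq (@lift_inj _ _)) ffunE.
by rewrite (negPf (neq_lift _ _)).
Qed.

Lemma step_vdir x h : step (col x h) vdir = col x (h + 1).
Proof.
apply/ffunP => i; rewrite !ffunE /=; case: unliftP => [j ->|->].
  by rewrite eq_sym (negPf (neq_lift _ _)).
by rewrite eqxx.
Qed.

Lemma hdir_inj : injective hdir.
Proof.
move=> [i b] [j b'] e; have /= /lift_inj -> := congr1 fst e.
by have /= -> := congr1 snd e.
Qed.

Lemma dirP (a : dir d.+1) : (exists u, a = hdir u) \/ a.1 = ord_max.
Proof.
case: a => i b; case: (unliftP ord_max i) => [j ->|->]; last by right.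
by left; exists (j, b).
Qed.

(** Without the upward direction, the [k + 1] chosen ones are horizontal except possibly the
    downward one, which leaves at least [k] horizontal. *)
Lemma vdir_mem k S : #|S| = k.+1 -> (#|hor S| < k)%N -> vdir \in S.
Proof.
move=> Sk; apply: contraTT => vS; rewrite -leqNgt -ltnS -Sk.
have /fintype.subset_leq_card/leq_trans -> // :
    (S \subset (ord_max, false) |: hdir @: hor S)%SET.
  apply/fintype.subsetP => a aS; rewrite !inE.
  have [[u au]|] := dirP a.
    by rewrite au imset_f ?orbT // inE -au.
  case: a aS => i b aS /= i_max; rewrite {i}i_max in aS *.
  by case: b aS => [aS|_]; [rewrite /vdir aS in vS|rewrite eqxx].
by rewrite (leq_trans (leq_card_setU _ _)) // cards1 (card_imset _ hdir_inj).
Qed.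

(** Extend the permutation by the identity on the two vertical directions and act on sets of
    directions. This supplies the symmetry [mu_perm] of the climb. *)
Lemma hor_perm {R : realFieldType} k (s : {perm dir d}) :
  exists f : {set dir d.+1} -> {set dir d.+1},
  [/\ injective f, forall S, unif k (f S) = unif k S :> R
    & forall S, hor (f S) = [set s x | x in hor S]%SET].
Proof.
pose g (a : dir d.+1) :=
  if unlift ord_max a.1 is Some j then hdir (s (j, a.2)) else a.
have gh u : g (hdir u) = hdir (s u).
  by rewrite /g /= liftK; case: u.
have gv a : a.1 = ord_max -> g a = a by rewrite /g => ->; rewrite unlift_none.
have hv u a : a.1 = ord_max -> hdir u <> a.
  by move=> + ua; rewrite -ua => /= /eqP; rewrite eq_sym (negPf (neq_lift _ _)).
have g_inj : injective g.
  move=> a b; have [[u ->]|am] := dirP a; have [[v ->]|bm] := dirP b.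
  - by rewrite !gh => /hdir_inj/perm_inj->.
  - by rewrite gh gv // => /hv; case.
  - by rewrite gh gv // => /esym /hv; case.
  - by rewrite !gv.
exists (fun S => [set g a | a in S]%SET); split.
- exact: imset_inj.
- by move=> S; rewrite /unif card_imset.
- move=> S; apply/setP => u; rewrite !inE.
  apply/imsetP/imsetP => [[a aS ua]|[v + ->]].
    have [[v av]|am] := dirP a.
      exists v; first by rewrite inE -av.
      by apply: hdir_inj; rewrite ua av gh.
    by rewrite gv // in ua; case: (hv u a am).
  by rewrite inE => vS; exists (hdir v); rewrite ?gh.
Qed.

Lemma card_dir : #|{: dir d}| = d.*2.
Proof. by rewrite card_prod card_ord card_bool muln2. Qed.

End Lift.

(** * Exploration of the out-cluster in Z^d *)

Section Exploration.
Context {R : realFieldType}.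
Variables (k d : nat).
Implicit Types (xs Q : seq (vertex d)).

(** A queue in which a vertex may occur several times: once it is explored, the filter drops its
    other copies. *)
Definition frontier x xs Q (S : {set dir d}) :=
  [seq y <- Q ++ [seq step x u | u <- enum S] | y \notin x :: xs].

(* The probability that the exploration of the out-cluster of [Q] in the
   [k]-DnG, with [xs] already explored, runs for at least [n] more steps. *)
Fixpoint explore n xs Q : R :=
  match n, Q with
  | 0%N, _ => 1
  | _.+1, [::] => 0
  | n'.+1, x :: Q' =>
      \sum_S unif k S * explore n' (x :: xs) (frontier x xs Q' S)
  end.

Lemma explore_ge0 n xs Q : 0 <= explore n xs Q.
Proof.
elim: n xs Q => [|n IH] xs [|x Q] //=.
by apply: sumr_ge0 => S _; rewrite mulr_ge0 ?unif_ge0.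
Qed.

Hypothesis kd : (k <= d.*2)%N.

Lemma explore_le1 n xs Q : explore n xs Q <= 1.
Proof.
elim: n xs Q => [|n IH] xs [|x Q] //=.
rewrite -(@sum_unif1 R (dir d) k) ?card_dir //.
by apply: ler_sum => S _; rewrite -[leRHS]mulr1 ler_wpM2l ?unif_ge0.
Qed.

End Exploration.

(** * Cylinder events and measurability *)

Definition update (V : eqType) (A : Type) (c : V -> A) (v : V) (S : A) : V -> A :=
  fun y => if y == v then S else c y.

Section Cylinders.
Context {R : realType} {dT : measure_display} {T : measurableType dT}.
Variables (P : probability T R) (k d : nat) (w : vertex d -> T -> {set dir d}).
Hypothesis law : kDnG_law P k d w.
Implicit Types (vs : seq (vertex d)) (c : config d) (B : set T).

Definition cyl vs c : set T := [set t | forall x, x \in vs -> w x t = c x].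

Definition weight vs c : R := \prod_(x <- vs) unif k (c x).

Lemma weight_ge0 vs c : 0 <= weight vs c.
Proof. by apply: prodr_ge0 => x _; apply: unif_ge0. Qed.

Lemma cyl_nil c : cyl [::] c = setT.
Proof. by apply/seteqP; split. Qed.

Lemma cyl_cons v vs c : cyl (v :: vs) c = [set t | w v t = c v] `&` cyl vs c.
Proof.
apply/seteqP; split=> t /= => [wc|[wv wc] x].
  by split=> [|x xvs]; apply: wc; rewrite inE ?eqxx ?xvs ?orbT.
by rewrite inE => /predU1P[->//|/wc].
Qed.

Lemma measurable_cyl vs c : measurable (cyl vs c).
Proof.
elim: vs => [|v vs IH]; first by rewrite cyl_nil.
by rewrite cyl_cons; apply: measurableI => //; apply: law.1.
Qed.

Lemma prob_cyl vs c : uniq vs -> P (cyl vs c) = (weight vs c)%:E.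
Proof.
move=> /(law.2 vs c) ->; congr (_%:E); apply: eq_bigr => x _.
by rewrite /unif card_dir.
Qed.

Lemma cyl_update vs c v S : v \notin vs ->
  cyl (v :: vs) (update c v S) = [set t | w v t = S] `&` cyl vs c.
Proof.
move=> vvs; rewrite cyl_cons /update eqxx; congr (_ `&` _).
apply/seteqP; split=> t wc x xvs; have := wc x xvs;
  by case: eqP => // xv; rewrite -xv xvs in vvs.
Qed.

Lemma weight_update vs c v S : v \notin vs ->
  weight (v :: vs) (update c v S) = unif k S * weight vs c.
Proof.
move=> vvs; rewrite /weight big_cons /update eqxx; congr (_ * _).
apply: eq_big_seq => x xvs; case: eqP => // xv.
by rewrite -xv xvs in vvs.
Qed.

(** Total probability over the value of [w v]: the revealing step of both bounds. *)
Lemma prob_reveal vs c v B : measurable B -> v \notin vs ->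
  P (cyl vs c `&` B)
    = (\sum_S P (cyl (v :: vs) (update c v S) `&` B))%E.
Proof.
move=> mB vvs.
pose F S := cyl (v :: vs) (update c v S) `&` B.
have -> : cyl vs c `&` B = \bigcup_(S in [set` index_enum {set dir d}]) F S.
  apply/seteqP; split=> [t [ct Bt]|t [S _]]; rewrite /F ?cyl_update //.
    by exists (w v t) => /=; rewrite ?mem_index_enum // cyl_update.
  by move=> [[_ ct] Bt].
rewrite measure_fin_bigcup //.
- by rewrite -fsbig_seq ?index_enum_uniq.
- move=> S S' _ _ [t []]; rewrite /F !cyl_update //.
  by move=> [[wS _] _] [[wS' _] _]; exact: etrans (esym wS) wS'.
- by move=> S _; apply: measurableI => //; apply: measurable_cyl.
Qed.

Lemma measurable_edge x y : measurable [set t | edge (w^~ t) x y].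
Proof.
have -> : [set t | edge (w^~ t) x y]
    = \bigcup_(S in [set S : {set dir d} | [exists u, (u \in S) && (y == step x u)]])
        [set t | w x t = S].
  apply/seteqP; split=> [t xy|t [S + wS]]; first by exists (w x t).
  by have <- : w x t = S := wS.
by apply: fin_bigcup_measurable => [|S _]; [exact: finite_finset|exact: law.1].
Qed.

Lemma measurable_path x p : measurable [set t | path (edge (w^~ t)) x p].
Proof.
elim: p x => [|y p IH] x /=; first by rewrite (_ : mkset _ = setT) // -subTset.
rewrite (_ : mkset _ =
  [set t | edge (w^~ t) x y] `&` [set t | path (edge (w^~ t)) y p]).
  exact: measurableI (measurable_edge x y) (IH y).
by apply/seteqP; split=> t /andP.
Qed.

Lemma measurable_saw n : measurable [set t | saw (w^~ t) n].
Proof.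
pose F p := [set t | path (edge (w^~ t)) (origin d) p] `&`
            [set _ | uniq (origin d :: p) && (size p == n)].
have -> : [set t | saw (w^~ t) n] = \bigcup_p F p.
  apply/seteqP; split=> [t [p [pp up pn]]|t [p _ [pp /andP[up /eqP pn]]]].
    by exists p => //; split=> //=; apply/andP; rewrite pn.
  by exists p.
apply: countable_bigcupT_measurable; first exact: countableP.
move=> p; apply: measurableI; first exact: measurable_path.
case: (uniq _ && _).
  by rewrite (_ : mkset _ = setT) // -subTset.
by rewrite (_ : mkset _ = set0) // -subset0.
Qed.

Lemma perc_event_bigcap : perc_event w = \bigcap_n [set t | saw (w^~ t) n].
Proof.
apply/seteqP; split=> t h; last by apply/(reaches_infinityP _).2 => n; apply: h.
by move=> n _; apply: (reaches_infinityP _).1 h n.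
Qed.

Lemma measurable_perc : measurable (perc_event w).
Proof.
by rewrite perc_event_bigcap; apply: bigcapT_measurable => n; apply: measurable_saw.
Qed.

End Cylinders.

(** * Percolation in Z^d bounded above by the exploration *)

Section UpperBound.
Context {R : realType} {dT : measure_display} {T : measurableType dT}.
Variables (P : probability T R) (k d : nat) (w : vertex d -> T -> {set dir d}).
Hypothesis law : kDnG_law P k d w.

(** Induction on [n], with the invariant that every edge out of [xs] leads into [xs ++ Q]: reveal
    the head of [Q] and sum over its value. *)
Lemma prob_perc_le_explore n (xs Q : seq (vertex d)) (c : config d) :
  uniq xs -> (forall y, y \in Q -> y \notin xs) ->
  origin d \in xs ++ Q ->
  (forall x u, x \in xs -> u \in c x -> step x u \in xs ++ Q) ->
  (P (cyl w xs c `&` perc_event w) <= (weight k xs c * explore k n xs Q)%:E)%E.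
Proof.
elim: n xs Q c => [|n IH] xs Q c ux Qxs oxs cxs.
  rewrite mulr1 -(prob_cyl law) //; apply: le_measure; rewrite ?inE.
  - apply: measurableI; first exact: measurable_cyl law _ _.
    exact: measurable_perc law.
  - exact: measurable_cyl law _ _.
  - by move=> t [].
case: Q Qxs oxs cxs => [|x Q] Qxs oxs cxs /=.
  (* With an empty queue, the finite set [xs] contains the origin and is closed under edges, so no
     infinite path exists. *)
  rewrite cats0 in oxs cxs.
  suff -> : cyl w xs c `&` perc_event w = set0 by rewrite measure0 mulr0.
  apply/seteqP; split=> // t [wc]; apply: finite_trap oxs _ => y u yxs.
  by rewrite wc //; apply: cxs.
have xxs : x \notin xs by apply: Qxs; rewrite inE eqxx.
rewrite (prob_reveal law _ (measurable_perc law) xxs) mulr_sumr -sumEFin.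
apply: lee_sum => S _; rewrite mulrCA mulrA -(@weight_update R k d xs c x S) //.
have mem_front y : (y \in (x :: xs) ++ frontier x xs Q S) =
    [|| y \in x :: xs, y \in Q | y \in [seq step x u | u <- enum S]].
  by rewrite mem_cat mem_filter mem_cat; case: (y \in x :: xs).
apply: IH.
- by rewrite /= xxs.
- by move=> y; rewrite mem_filter => /andP[].
- by move: oxs; rewrite mem_front mem_cat !inE; case/or3P => ->; rewrite ?orbT.
- move=> y u; rewrite mem_front /update inE; case: eqVneq => [-> _ uS|yx /= yxs uy].
    by rewrite (map_f (step x)) ?mem_enum ?orbT.
  have := cxs y u yxs uy; rewrite mem_cat !inE.
  by case/or3P => ->; rewrite ?orbT.
Qed.

End UpperBound.

(** * The exploration as a lower bound in Z^(d+1) *)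

Section LowerBound.
Context {R : realType} {dT : measure_display} {T : measurableType dT}.
Variables (P : probability T R) (k d : nat).
Variable w : vertex d.+1 -> T -> {set dir d.+1}.
Hypothesis law : kDnG_law P k.+1 d.+1 w.
Hypothesis kd : (k <= d.*2)%N.
(** [B] will be the event [saw] at a fixed length, with [N] taken from [saw_of_reach]. *)
Variables (B : set T) (N : nat).
Hypothesis mB : measurable B.
Hypothesis B_reach : forall t (s : seq (vertex d.+1)),
  uniq s -> (N <= size s)%N -> (forall y, y \in s -> reach (w^~ t) y) -> B t.
Implicit Types (vs : seq (vertex d.+1)) (c : config d.+1) (x : vertex d).
Implicit Types (S : {set dir d.+1}) (K U V : {set dir d}).
Implicit Types (xs : seq (vertex d)) (Q : seq (vertex d * int)).

(* [y] is reachable in view of the values of [c] on [vs] alone. *)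
Definition forced vs c y :=
  forall c', (forall v, v \in vs -> c' v = c v) -> reach c' y.

Lemma forced_update vs c v S y : v \notin vs ->
  forced vs c y -> forced (v :: vs) (update c v S) y.
Proof.
move=> vvs fy c' c'E; apply: fy => z zvs.
rewrite c'E ?inE ?zvs ?orbT // /update; case: eqP => // zv.
by rewrite -zv zvs in vvs.
Qed.

Lemma forced_step vs c v S u : v \notin vs -> u \in S ->
  forced vs c v -> forced (v :: vs) (update c v S) (step v u).
Proof.
move=> vvs uS fv c' c'E; apply: reach_step.
  by apply: (forced_update (S := S) vvs fv).
by rewrite c'E ?inE ?eqxx // /update eqxx.
Qed.

(** The revealed vertices are reachable throughout the cylinder, so [N] of them already force [B]
    there. *)
Lemma weight_le_prob vs c : uniq vs -> (N <= size vs)%N ->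
  (forall v, v \in vs -> forced vs c v) ->
  ((weight k.+1 vs c)%:E <= P (cyl w vs c `&` B))%E.
Proof.
move=> uvs Nvs fvs; rewrite -(prob_cyl law) //; apply: le_measure; rewrite ?inE.
- exact: measurable_cyl law _ _.
- by apply: measurableI => //; exact: measurable_cyl law _ _.
move=> t ct; split=> //; apply: B_reach uvs Nvs _ => y /fvs; apply.
exact: ct.
Qed.

(* [vs] are the revealed vertices, [c] their values, [xs] the explored columns and
   [Q] the lifts of the discovered but unexplored vertices. *)
Definition lower n := forall vs c xs Q,
  uniq vs -> (forall x h, col x h \in vs -> x \in xs) ->
  (forall v, v \in vs -> forced vs c v) ->
  (forall q, q \in Q -> forced vs c (col q.1 q.2) /\ q.1 \notin xs) ->
  (N <= size vs + n)%N ->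
  ((weight k.+1 vs c * explore k n xs (map fst Q))%:E <= P (cyl w vs c `&` B))%E.

(** Induction on the climb. The column of [x] is unrevealed from [h] upwards, so each choice is
    fresh; [hf u] is the height at which direction [u] was found. Each step reveals a new vertex, so
    once [m] is used up [N] vertices are revealed, which justifies the value 1. *)
Lemma climb_lower n x xs Q (pick : {set dir d} -> {set dir d}) :
  lower n ->
  (forall V, (k <= #|V|)%N -> (pick V \subset V)%SET /\ #|pick V| = k) ->
  forall m vs c h U (hf : dir d -> int),
  uniq vs -> (forall y h', col y h' \in vs -> y \in x :: xs) ->
  (forall h', h <= h' -> col x h' \notin vs) ->
  (forall v, v \in vs -> forced vs c v) ->
  (forall q, q \in Q -> forced vs c (col q.1 q.2)) ->
  forced vs c (col x h) ->
  (forall u, u \in U -> forced vs c (col (step x u) (hf u))) ->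
  (N <= size vs + m)%N -> (N <= size vs + n.+1)%N ->
  ((weight k.+1 vs c *
    climb k (@hor d) (unif k.+1) m
      (fun K => explore k n (x :: xs) (frontier x xs (map fst Q) K)) pick U)%:E
   <= P (cyl w vs c `&` B))%E.
Proof.
move=> IHn pickP; elim=> [|m IH] vs c h U hf uvs vsx hvs fvs fQ fx fU Nm Nn.
  by rewrite mulr1; apply: weight_le_prob => //; rewrite addn0 in Nm.
set v := col x h; have vvs : v \notin vs by apply: hvs.
rewrite (prob_reveal law _ mB vvs) /= mulr_sumr -sumEFin.
apply: lee_sum => S _; rewrite mulrCA mulrA -(@weight_update R k.+1 _ vs c v S) //.
have [Sk|Sk] := eqVneq #|S| k.+1; last first.
  by rewrite weight_update // /unif (negPf Sk) !mul0r.
set c' := update c v S; set V := (U :|: hor S)%SET.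
pose hf' u := if u \in U then hf u else h.
have uvs' : uniq (v :: vs) by rewrite /= vvs.
have vsx' y h' : col y h' \in v :: vs -> y \in x :: xs.
  by rewrite inE => /predU1P[/col_inj[-> _]|/vsx //]; rewrite inE eqxx.
have fvs' y : y \in v :: vs -> forced (v :: vs) c' y.
  by rewrite inE => /predU1P[->|/fvs]; apply: forced_update.
have fQ' q : q \in Q -> forced (v :: vs) c' (col q.1 q.2).
  by move=> /fQ; apply: forced_update.
have fV u : u \in V -> forced (v :: vs) c' (col (step x u) (hf' u)).
  rewrite inE /hf'; case: ifP => [/fU + _|_ /=]; first exact: forced_update.
  by rewrite inE -step_hdir => uS; apply: forced_step.
case: ifP => kV.
  have [pV _] := pickP V kV.
  (* Only selected directions are enqueued, each at the height where it was found; forgetting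
     heights gives the frontier in Z^d. *)
  pose L := Q ++ [seq (step x u, hf' u) | u <- enum (pick V)].
  pose Q' := [seq q <- L | q.1 \notin x :: xs].
  have -> : frontier x xs (map fst Q) (pick V) = map fst Q'.
    rewrite /frontier -[_ ++ _](_ : map fst L = _) ?filter_map //.
    by rewrite map_cat -map_comp.
  apply: IHn => //; last by rewrite /= addSnnS.
  move=> q; rewrite mem_filter mem_cat => /andP[qx /orP[/fQ' //|]].
  move=> /mapP[u + qu]; rewrite mem_enum => /(fintype.subsetP pV)/fV fu.
  by split=> //; rewrite qu.
(* Fewer than [k] horizontal directions in all means fewer than [k] at this vertex, so it points
   up. *)
have vS : vdir d \in S.
  apply: vdir_mem Sk _; rewrite (leq_ltn_trans _ (_ : #|V| < k)%N) //.
    by apply/fintype.subset_leq_card/finset.subsetUr.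
  by rewrite ltnNge kV.
apply: (IH _ _ (h + 1) _ hf') => //.
- move=> h' hh'; rewrite inE negb_or hvs ?andbT; last first.
    by apply: le_trans hh'; rewrite lerDl.
  by apply/eqP => /col_inj[_ hE]; rewrite hE -subr_ge0 opprD addrA subrr in hh'.
- by rewrite -step_vdir; apply: forced_step.
- by rewrite /= addSnnS.
- by rewrite (leq_trans Nn) //= addSn.
Qed.

Lemma lower_bound n : lower n.
Proof.
elim: n => [|n IH] vs c xs Q uvs vsx fvs fQ Nn.
  by rewrite mulr1; apply: weight_le_prob => //; rewrite addn0 in Nn.
case: Q fQ => [|[x h] Q] fQ /=; first by rewrite mulr0.
have [|fx xxs] := fQ (x, h); first by rewrite inE eqxx.
pose F K : R := explore k n (x :: xs) (frontier x xs (map fst Q) K).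
(* [F] is the value of the remaining exploration given the selected set, so the rule [pick] depends
   on the history. A climb of [N] steps suffices: it alone reveals [N] vertices. *)
have [|||||pick pickP le_climb] := @exists_pick R (dir d) {set dir d.+1} k
  (@hor d) (unif k.+1) _ _ _ _ N F _.
- by move=> S; apply: unif_ge0.
- by apply: sum_unif1; rewrite card_dir doubleS !ltnS leqW.
- exact: hor_perm.
- by rewrite card_dir.
- by move=> K; apply: explore_le1.
apply: (@le_trans _ _ (weight k.+1 vs c * climb k (@hor d) (unif k.+1) N F pick
   finset.set0)%:E).
  by rewrite lee_fin ler_wpM2l ?weight_ge0.
(* No direction has been found yet, so [hf] may start as any function, here 0. *)
apply: (climb_lower IH pickP (h := h) (hf := fun=> 0)) => //.
- by move=> y h' /vsx yxs; rewrite inE yxs orbT.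
- by move=> h' _; apply: contra xxs => /vsx.
- by move=> q qQ; have [] := fQ q; rewrite ?inE ?qQ ?orbT.
- by move=> u; rewrite inE.
- by rewrite leq_addl.
Qed.

Lemma explore_le_prob : ((explore k N [::] [:: origin d])%:E <= P B)%E.
Proof.
have := @lower_bound N [::] (fun=> finset.set0) [::] [:: (origin d, 0)].
rewrite /weight big_nil mul1r cyl_nil setTI; apply=> //.
move=> q; rewrite inE => /eqP ->; split=> //= c' _.
by rewrite col_origin; apply: reach_origin.
Qed.

End LowerBound.

Theorem theorem2p6 (R : realType) (k d : nat) (hk : (1 <= k)%N) (hd : (1 <= d)%N)
    (hkd : (k <= d.*2)%N)
    (dT1 : measure_display) (T1 : measurableType dT1) (P1 : probability T1 R)
    (w1 : vertex d -> T1 -> {set dir d})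
    (dT2 : measure_display) (T2 : measurableType dT2) (P2 : probability T2 R)
    (w2 : vertex d.+1 -> T2 -> {set dir d.+1}) :
  kDnG_law P1 k d w1 -> kDnG_law P2 k.+1 d.+1 w2 ->
  (P1 (perc_event w1) <= P2 (perc_event w2))%E.
Proof.
move=> law1 law2.
(* The probability that the exploration runs for [N] steps lies between the two sides. *)
have le_saw n : (P1 (perc_event w1) <= P2 [set t | saw (w2^~ t) n])%E.
  have [N sawN] := saw_of_reach d.+1 n.
  apply: (@le_trans _ _ (explore k N [::] [:: origin d])%:E).
    have := @prob_perc_le_explore R _ _ P1 k d w1 law1 N [::] [:: origin d]
      (fun=> finset.set0).
    rewrite /weight big_nil mul1r cyl_nil setTI; apply=> //.
    by rewrite inE.
  apply: (explore_le_prob law2 hkd (measurable_saw law2 n)) => t s us Ns sr.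
  exact: sawN us Ns sr.
rewrite (perc_event_bigcap w2).
apply: (cvge_ge (F := eventually) (f := P2 \o (fun n => [set t | saw (w2^~ t) n]))).
  by apply: nearW => n; apply: le_saw.
apply: nonincreasing_cvg_mu.
- rewrite (le_lt_trans (probability_le1 P2 _)) ?ltry //.
  exact: measurable_saw law2 _.
- exact: measurable_saw law2.
- by apply: bigcapT_measurable; apply: measurable_saw law2.
- by move=> m n mn; apply/subsetPset => t; apply: saw_leq.
Qed.
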